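(* A linearly ordered set $I$ is spherically complete w.r.t. the order balls if and only if every nonprincipal cut in $I$ is asymmetric.
   Context: A linearly ordered set $I$ is called spherically complete w.r.t. the order balls if every nonempty chain (w.r.t. inclusion) of closed bounded intervals $[a,b]=\{c\in I\mid a\le c\le b\}$ ($a\le b$ in $I$) has nonempty intersection. A cut in $I$ is a pair $(D,E)$ of nonempty subsets of $I$ with $I=D\cup E$ and $d<e$ for all $d\in D$, $e\in E$. The cofinality of the cut is the pair $(\kappa,\lambda)$ where $\kappa=\mathrm{cf}(D)$ is the cofinality of $D$ and $\lambda=\mathrm{ci}(E)$ is the coinitiality of $E$, i.e. the cofinality of $E$ under the reversed ordering (so $\kappa=1$ iff $D$ has a maximal element, $\lambda=1$ iff $E$ has a minimal element). The cut is principal if $D$ has a maximal element or $E$ has a minimal element. The cut is asymmetric if $\kappa\neq\lambda$. *)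

(* Defs.v *)
From mathcomp Require Import all_boot all_order.
From mathcomp Require Import boolp classical_sets functions cardinality.
From mathcomp Require Import interval set_interval.

Set Implicit Arguments.
Unset Strict Implicit.
Unset Printing Implicit Defensive.

Import Order.TTheory.

Local Open Scope classical_set_scope.
Local Open Scope card_scope.
Local Open Scope order_scope.

Lemma ex_card_min T (F : set (set T)) : F !=set0 ->
  exists2 A, F A & forall B, F B -> A #<= B.
Proof.
move=> [A0 FA0].
pose P (S : set (set T -> T)) :=
  (forall s A, S s -> F A -> A (s A)) /\
  (forall s t A, S s -> S t -> F A -> s A = t A -> s = t).
have [|S [[S1 S2] Smax]] := @Zorn_bigcup _ P.
  move=> G GP tot; split=> [s A [X GX Xs] FA|s t A [X GX Xs] [Y GY Yt] FA e].
    exact: ((GP _ GX).1 _ _ Xs FA).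
  case: (tot _ _ GX GY) => [XY|YX].
    exact: ((GP _ GY).2 _ _ _ (XY _ Xs) Yt FA e).
  exact: ((GP _ GX).2 _ _ _ Xs (YX _ Yt) FA e).
have [A [FA AS]] : exists A, F A /\ A `<=` [set s A | s in S].
  apply: contrapT => no.
  have H A : F A -> exists x, A x /\ ~ [set s A | s in S] x.
    move=> FA; apply: contrapT => nx; apply: no; exists A; split=> // x Ax.
    by apply: contrapT => nS; apply: nx; exists x.
  have [x0 _] := H _ FA0.
  have /choice[s0 Hs0] : forall A, exists x, F A -> A x /\ ~ [set s A | s in S] x.
    move=> A; have [/H[x ?]|nF] := pselect (F A); first by exists x.
    by exists x0.
  have nS s A : S s -> F A -> s A <> s0 A.
    by move=> Ss FA e; apply: (Hs0 A FA).2; exists s.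
  apply: (Smax (S `|` [set s0])).
    split=> [s|/(_ s0)]; first by left.
    by move=> /(_ (or_intror erefl)) Ss0; exact: (nS s0 A0).
  split=> [s A [Ss|->] FA|s t A [Ss|->] [St|->] FA e //].
  - exact: (S1 _ _ Ss FA).
  - by case: (Hs0 A FA).
  - exact: (S2 _ _ _ Ss St FA e).
  - by case: (nS s A Ss FA e).
  - by case: (nS t A St FA (esym e)).
exists A => // B FB.
apply: card_le_trans (subset_card_le AS) _.
apply: card_le_trans (card_image_le _ _) _.
have inj : {in S &, injective (fun s : set T -> T => s B)}.
  by move=> s t /set_mem Ss /set_mem St e; exact: (S2 _ _ _ Ss St FB e).
have := inj_card_eq inj; rewrite card_eq_le => /andP[_ h].
apply: card_le_trans h _; apply: subset_card_le => _ [s Ss <-]; exact: (S1 _ _ Ss FB).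
Qed.

Definition order_ball d (T : orderType d) (B : set T) : Prop :=
  exists a b : T, a <= b /\ B = `[a, b]%classic.

Definition spherically_complete d (T : orderType d) : Prop :=
  forall F : set (set T),
    F !=set0 -> F `<=` @order_ball d T -> total_on F subset ->
    \bigcap_(B in F) B !=set0.

Definition cofinal d (T : porderType d) (D C : set T) : Prop :=
  C `<=` D /\ forall x, D x -> exists2 y, C y & x <= y.

(* The least cardinality of a cofinal subset of D. A cardinal is encoded as
   an equipotence class of subsets of T, so that equality of cofinalities of
   two subsets of T is Leibniz equality. *)
Definition cofinality d (T : porderType d) (D : set T) : set (set T) :=
  [set X | exists2 C, cofinal D C /\ (forall C', cofinal D C' -> C #<= C')
                    & X #= C].

(* The class above is never the degenerate empty one. *)
Lemma cofinality_neq0 d (T : porderType d) (D : set T) : cofinality D !=set0.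
Proof.
have [|C DC Cmin] := @ex_card_min _ [set C | cofinal D C].
  by exists D; split=> // x Dx; exists x.
by exists C; exists C.
Qed.

Definition coinitiality d (T : porderType d) (E : set T) : set (set T) :=
  @cofinality _ T^d E.

Definition cut d (T : porderType d) (D E : set T) : Prop :=
  [/\ D !=set0, E !=set0, D `|` E = setT
    & forall x y, D x -> E y -> x < y].

Definition principal d (T : porderType d) (D E : set T) : Prop :=
  D `&` ubound D !=set0 \/ E `&` lbound E !=set0.

Definition asymmetric d (T : porderType d) (D E : set T) : Prop :=
  cofinality D <> coinitiality E.

(* Main.v *)
Require Import Defs.
From HB Require Import structures.
From mathcomp Require Import all_boot all_order.
From mathcomp Require Import boolp classical_sets functions cardinality.
From mathcomp Require Import interval set_interval.
From mathcomp Require Import wochoice.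

(** If the balls [B] of a chain have no common point, their lower and upper
    endpoints determine a nonprincipal cut (D, E). Sending each element of a
    cofinal subset C of D to the upper endpoint of a ball lying above it yields
    a coinitial subset of E no larger than C; by symmetry the cofinality and
    the coinitiality agree.

    Conversely, let (D, E) be nonprincipal with both cofinalities equal to
    kappa. Enumerate minimal cofinal and coinitial subsets along one well-order
    of type kappa. Proper initial segments are not cofinal, so both enumerations
    are dominated by monotone families a_i in D and b_i in E, and the balls
    [a_i, b_i] form a chain without a common point. *)

Set Implicit Arguments.
Unset Strict Implicit.
Unset Printing Implicit Defensive.

Import Order.TTheory.

Local Open Scope classical_set_scope.
Local Open Scope card_scope.
Local Open Scope order_scope.

(** * Well-orders and their initial segments *)

Lemma well_order_min (U : Type) (R : rel U) (A : set U) : well_order R ->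
  A !=set0 -> exists2 z, A z & forall x, A x -> R z x.
Proof.
move=> wo [x0 Ax0].
have [|z [[/asboolP Az zmin] _]] := wo [pred x | `[< A x >]].
  by exists x0; apply/asboolP.
by exists z => // x Ax; apply: zmin; apply/asboolP.
Qed.

Lemma well_order_total (U : Type) (R : rel U) x y :
  well_order R -> R x y \/ R y x.
Proof.
move=> /(@well_order_min _ _ [set x; y])[|z]; first by exists x; left.
by case=> -> zmin; [left|right]; apply: zmin; [right|left].
Qed.

Lemma well_order_anti (U : eqType) (R : rel U) x y :
  well_order R -> R x y -> R y x -> x = y.
Proof.
move=> /(@withinW _ predT)/wo_chain_antisymmetric anti xy yx.
by apply: anti => //; rewrite xy yx.
Qed.

(** The least of [x], [y], [z] is [x], or else antisymmetry identifies [y] with [x] or with [z]. *)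
Lemma well_order_trans (U : eqType) (R : rel U) y x z :
  well_order R -> R x y -> R y z -> R x z.
Proof.
move=> wo xy yz; have [//|zx] := well_order_total x z wo.
have [|t] := @well_order_min _ _ [set t | t = x \/ t = y \/ t = z] wo.
  by exists x; left.
move=> [|[|]] -> tmin.
- by apply: tmin; right; right.
- by rewrite (well_order_anti wo xy (tmin _ (or_introl erefl))).
- by rewrite -(well_order_anti wo yz (tmin _ (or_intror (or_introl erefl)))).
Qed.

(* [R] on [K] plays the role of the initial ordinal of the cardinal of [C]. *)
Lemma ex_initial_well_order (U : eqType) (C : set U) :
  exists (R : rel U) (K : set U), [/\ well_order R, C #= K &
    forall k, K k -> ~ (C #<= [set j | [/\ K j, R j k & j <> k]])].
Proof.
have [R wo] := well_ordering_principle U; exists R.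
(* [S] holds the points of [C] whose initial segment is as large as [C]. Cutting at the least of
   them, or keeping all of [C] if there is none, gives [K]. *)
pose S := [set i | C i /\ C #<= [set j | [/\ C j, R j i & j <> i]]].
have [/(well_order_min wo)[i [Ci Si] imin]|noS] := pselect (S !=set0); last first.
  by exists C; split=> // k Ck Sk; apply: noS; exists k.
exists [set j | [/\ C j, R j i & j <> i]]; split=> //.
  by rewrite card_eq_le Si; apply: subset_card_le => j [].
move=> k [Ck ki nki] Sk; apply: nki; apply: (well_order_anti wo) => //.
apply: imin; split=> //; apply: card_le_trans Sk _.
by apply: subset_card_le => j [[]].
Qed.

(** Take [a i] to be the value of [f] at the least index where [f] exceeds every [f j] with [R j i].
    Such indices exist because proper initial segments of [K] are too small to be cofinal; leastness
    yields monotonicity. *)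
Lemma monotone_domination (d : Order.disp_t) (T : orderType d) (D C : set T)
    (U : eqType) (R : rel U) (K : set U) (f : U -> T) :
  (forall x, D x -> exists2 y, D y & x < y) ->
  cofinal D C -> (forall C', cofinal D C' -> C #<= C') ->
  well_order R ->
  (forall k, K k -> ~ (C #<= [set j | [/\ K j, R j k & j <> k]])) ->
  f @` K = C ->
  exists a : U -> T,
    (forall i, K i -> D (a i) /\ f i <= a i) /\
    (forall i j, K i -> K j -> R i j -> a i <= a j).
Proof.
move=> nomax [CD Ccof] Cmin wo Ksmall fK.
have Df k : K k -> D (f k) by move=> Kk; apply: CD; rewrite -fK; exists k.
pose P i := [set k | K k /\ forall j, K j -> R j i -> f j < f k].
have Pne i : K i -> P i !=set0.
  move=> Ki; pose J := [set j | [/\ K j, R j i & j <> i]].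
  (* Without such an [x], the image of [J] would be cofinal, so [C #<= J] by minimality of [C]. *)
  have [x Dx xJ] : exists2 x, D x & forall j, J j -> f j < x.
    apply: contrapT => nox; apply: (Ksmall i Ki).
    apply: card_le_trans (card_image_le f J); apply: Cmin; split.
      by move=> _ [j [Kj _ _] <-]; exact: Df.
    move=> x Dx; apply: contrapT => noy; apply: nox; exists x => // j Jj.
    by rewrite ltNge; apply/negP => xj; apply: noy; exists (f j) => //; exists j.
  have [y Dy [xy fiy]] : exists2 y, D y & x < y /\ f i < y.
    have [xfi|/ltW fix_] := leP x (f i).
      by have [y Dy fiy] := nomax _ (Df _ Ki); exists y; rewrite // (le_lt_trans xfi).
    by have [y Dy xy] := nomax _ Dx; exists y; rewrite // (le_lt_trans fix_).
  have [c] := Ccof y Dy; rewrite -fK => -[k Kk <-] yc.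
  exists k; split=> // j Kj ji; apply: lt_le_trans yc.
  have [-> //|/eqP nji] := eqVneq j i.
  by apply: lt_trans xy; apply: xJ.
have /choice[m mP] : forall i, exists k,
    K i -> P i k /\ forall l, P i l -> R k l.
  move=> i; have [Ki|nKi] := pselect (K i); last by exists i.
  by have [k Pk kmin] := well_order_min wo (Pne i Ki); exists k.
exists (f \o m); split=> [i Ki|i j Ki Kj ij] /=.
  have [[Km fm] _] := mP i Ki; split; first exact: Df.
  by apply/ltW/fm => //; have [] := well_order_total i i wo.
have [[Kmi fmi] mimin] := mP i Ki; have [Pmj mjmin] := mP j Kj.
have Pimj : P i (m j).
  by split=> [|l Kl li]; [exact: Pmj.1|apply: Pmj.2 => //; exact: well_order_trans li ij].
(* If [m i] is in [P j], both least indices coincide. Otherwise [f (m i)] cannot exceed [f (m j)],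
   which would put [m i] in [P j]. *)
have [Pjmi|nPjmi] := pselect (P j (m i)).
  by rewrite (well_order_anti wo (mimin _ Pimj) (mjmin _ Pjmi)).
rewrite leNgt; apply/negP => ji; apply: nPjmi; split=> // l Kl lj.
by apply: lt_trans ji; apply: Pmj.2.
Qed.

(** * From spherical completeness to asymmetric cuts *)

Lemma cut_nomax (d : Order.disp_t) (T : orderType d) (D : set T) :
  ~ (D `&` ubound D !=set0) -> forall x, D x -> exists2 y, D y & x < y.
Proof.
move=> nomax x Dx; apply: contrapT => noy; apply: nomax; exists x; split=> // y Dy.
by rewrite leNgt; apply/negP => xy; apply: noy; exists y.
Qed.

Lemma spherically_complete_asymmetric (d : Order.disp_t) (I : orderType d)
    (D E : set I) :
  spherically_complete I -> cut D E -> ~ principal D E -> asymmetric D E.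
Proof.
move=> sc [[d0 Dd0] _ DE DltE] nprin eqDE.
have Dnomax : forall x, D x -> exists2 y, D y & x < y.
  by apply: cut_nomax => ?; apply: nprin; left.
have Enomin : forall x, E x -> exists2 y, E y & y < x.
  by apply: (@cut_nomax _ I^d) => ?; apply: nprin; right.
have [C [DC Cmin]] : exists C, cofinal D C /\ (forall C', cofinal D C' -> C #<= C').
  by have [? [C + _]] := cofinality_neq0 D; exists C.
have : coinitiality E C by rewrite -eqDE; exists C.
move=> [C' [EC' C'min] CC'].
have [R [K [wo CK Ksmall]]] := ex_initial_well_order C.
have [k0 Kk0] : K !=set0.
  have [x Cx _] := DC.2 _ Dd0; apply/set0P; apply/eqP => K0.
  by move: CK; rewrite K0 card_eq0 => /eqP C0; move: Cx; rewrite C0.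
pose pI : pointedType := HB.pack_for pointedType I (isPointed.Build I d0).
have KC : K #= C by rewrite card_eq_sym.
have [f [+ _ +]] := elimT (@card_set_bijP _ pI K C) KC.
move=> /image_subP fKs fKi.
have fK : f @` K = C by apply/seteqP; split.
have [g [gKs _ gKi]] := elimT (@card_set_bijP _ pI K C') (card_eq_trans KC CC').
have gK : g @` K = C' by apply/seteqP; split => //; apply/image_subP.
have [a [aP amono]] := monotone_domination Dnomax DC Cmin wo Ksmall fK.
(* Equal cofinalities make [C] and [C'] equipotent, so the same [K] indexes both. *)
have Ksmall' k : K k -> ~ (C' #<= [set j | [/\ K j, R j k & j <> k]]).
  by move=> Kk; rewrite -(card_le_eql CC'); exact: Ksmall.
have [b [bP bmono]] : exists b : I -> I,
    (forall i, K i -> E (b i) /\ b i <= g i) /\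
    (forall i j, K i -> K j -> R i j -> b j <= b i).
  exact: (@monotone_domination _ I^d E C' _ R K g).
have [] := sc [set `[a i, b i]%classic | i in K].
- by exists `[a k0, b k0]%classic; exists k0.
- move=> _ [i Ki <-]; exists (a i), (b i); split=> //.
  by apply/ltW/DltE; [exact: (aP i Ki).1|exact: (bP i Ki).1].
- have nest i j : K i -> K j -> R i j -> `[a j, b j] `<=` `[a i, b i].
    move=> Ki Kj ij x; rewrite /= !in_itv /= => /andP[ajx xbj].
    by rewrite (le_trans (amono i j Ki Kj ij) ajx) (le_trans xbj (bmono i j Ki Kj ij)).
  move=> _ _ [i Ki <-] [j Kj <-].
  by have [ij|ji] := well_order_total i j wo; [right|left]; exact: nest.
move=> x xF.
have xab i : K i -> a i <= x <= b i.
  by move=> Ki; have := xF `[a i, b i]%classic; rewrite /= in_itv; apply; exists i.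
have : (D `|` E) x by rewrite DE.
(* A common point in [D] lies strictly below some [a k], one in [E] strictly above some [b k]. *)
move=> [/Dnomax[y Dy xy]|/Enomin[y Ey yx]].
  have [c] := DC.2 y Dy; rewrite -fK => -[k Kk <-] yc.
  have /andP[akx _] := xab k Kk.
  have := lt_le_trans xy (le_trans yc (le_trans (aP k Kk).2 akx)).
  by rewrite ltxx.
have [c] := EC'.2 y Ey; rewrite -gK => -[k Kk <-] cy.
have /andP[_ xbk] := xab k Kk.
have gky : (g k : I) <= y by [].
have := le_lt_trans (le_trans xbk (le_trans (bP k Kk).2 gky)) yx.
by rewrite ltxx.
Qed.

(** * From asymmetric cuts to spherical completeness *)

(** Each [c] in [C] has a member of [F] strictly above it, whose maximum is [b c]; these maxima are
    coinitial in [E]. Asking only for minima and maxima makes the hypotheses self-dual, so that the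
    result also applies in the reversed order. *)
Lemma chain_card_le (d : Order.disp_t) (T : orderType d) (F : set (set T))
    (D E C : set T) :
  total_on F subset ->
  (forall B, F B -> B `&` lbound B !=set0) ->
  (forall B, F B -> B `&` ubound B !=set0) ->
  D = [set x | exists2 B, F B & lbound B x] ->
  E = [set x | exists2 B, F B & ubound B x] ->
  (forall x, D x -> exists2 y, D y & x < y) ->
  cofinal D C -> exists2 C', @cofinal _ T^d E C' & C' #<= C.
Proof.
move=> tot Flo Fup -> -> nomax [CD Ccof].
have /choice[b bP] : forall c, exists b, C c -> exists B,
    [/\ F B, B b, ubound B b & forall y, B y -> c < y].
  move=> c; have [Cc|nCc] := pselect (C c); last by exists c.
  have [y [B FB By] cy] := nomax c (CD c Cc).
  have [b [Bb bub]] := Fup B FB.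
  exists b => _; exists B; split=> // z /By; exact: lt_le_trans.
exists (b @` C); last exact: card_image_le.
split=> [_ [c /bP[B [FB _ ? _]] <-]|y [B FB By]]; first by exists B.
have [a [Ba alo]] := Flo B FB.
have [|c Cc ac] := Ccof a; first by exists B.
have [B' [FB' B'b _ cB']] := bP c Cc.
exists (b c); first by exists c.
(* If [B] were inside [B'], its minimum [a] would lie above [c], against [a <= c]. *)
have [BB'|B'B] := tot _ _ FB FB'; last exact/By/B'B.
by have := lt_le_trans (cB' a (BB' _ Ba)) ac; rewrite ltxx.
Qed.

Lemma asymmetric_spherically_complete (d : Order.disp_t) (I : orderType d) :
  (forall D E : set I, cut D E -> ~ principal D E -> asymmetric D E) ->
  spherically_complete I.
Proof.
move=> asym F [B0 FB0] Fball tot; apply: contrapT => Fempty.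
have Flo B : F B -> B `&` lbound B !=set0.
  move=> /Fball[a [b [ab ->]]]; exists a; split; first by rewrite /= in_itv /= lexx.
  by move=> x; rewrite /= in_itv /= => /andP[].
have Fup B : F B -> B `&` ubound B !=set0.
  move=> /Fball[a [b [ab ->]]]; exists b; split; first by rewrite /= in_itv /= lexx andbT.
  by move=> x; rewrite /= in_itv /= => /andP[].
have Fout x : exists2 B, F B & ~ B x.
  apply: contrapT => nB; apply: Fempty; exists x => B FB.
  by apply: contrapT => nBx; apply: nB; exists B.
pose D : set I := [set x | exists2 B, F B & lbound B x].
pose E : set I := [set x | exists2 B, F B & ubound B x].
have DEx x B : F B -> ~ B x -> (lbound B x \/ ubound B x).
  move=> /Fball[a [b [ab ->]]]; rewrite /= in_itv /= => /negP.
  rewrite negb_and -!ltNge => /orP[xa|bx]; [left|right] => y /=;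
    rewrite in_itv /= => /andP[ay yb].
    exact: le_trans (ltW xa) ay.
  exact: le_trans yb (ltW bx).
have DltE x y : D x -> E y -> x < y.
  move=> [B FB Bx] [B' FB' By].
  have [B1 FB1 [B1x B1y]] : exists2 B1, F B1 & lbound B1 x /\ ubound B1 y.
    have [BB'|B'B] := tot _ _ FB FB'.
      by exists B => //; split=> // z /BB'; exact: By.
    by exists B' => //; split=> // z /B'B; exact: Bx.
  have [z [Bz _]] := Flo _ FB1.
  rewrite lt_neqAle (le_trans (B1x z Bz) (B1y z Bz)) andbT.
  apply/eqP => xy; subst y.
  (* The ball [B1] collapses to [[set x]], so every ball contains [x]. *)
  have B1E w : B1 w -> w = x.
    by move=> Bw; apply/le_anti; rewrite (B1x w Bw) (B1y w Bw).
  have [B2 FB2 nB2x] := Fout x; apply: nB2x.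
  have [B12|B21] := tot _ _ FB1 FB2; first by apply: B12; rewrite -(B1E z Bz).
  by have [w [Bw _]] := Flo _ FB2; rewrite -(B1E w (B21 _ Bw)).
have noD : ~ (D `&` ubound D !=set0).
  (* Some ball misses the maximum [x]. Its left endpoint is in [D], hence at most [x]; so [x] lies
     above the ball and belongs to [E] too. *)
  move=> [x [Dx xub]]; have [B FB nBx] := Fout x.
  have [a [Ba alo]] := Flo B FB.
  have ax : a <= x by apply: xub; exists B.
  have [xlo|xup] := DEx x B FB nBx.
    by apply: nBx; rewrite (_ : x = a)//; apply/le_anti; rewrite ax xlo.
  have Ex : E x by exists B.
  by have := DltE x x Dx Ex; rewrite ltxx.
have noE : ~ (E `&` lbound E !=set0).
  move=> [x [Ex xlb]]; have [B FB nBx] := Fout x.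
  have [b [Bb bup]] := Fup B FB.
  have xb : x <= b by apply: xlb; exists B.
  have [xlo|xup] := DEx x B FB nBx; last first.
    by apply: nBx; rewrite (_ : x = b)//; apply/le_anti; rewrite xb xup.
  have Dx : D x by exists B.
  by have := DltE x x Dx Ex; rewrite ltxx.
apply: (asym D E) => [||].
- split=> //.
  + by have [a [_ alo]] := Flo _ FB0; exists a; exists B0.
  + by have [b [_ bup]] := Fup _ FB0; exists b; exists B0.
  apply/seteqP; split=> // x _; have [B FB nBx] := Fout x.
  by have [xlo|xup] := DEx x B FB nBx; [left|right]; exists B.
- by move=> [].
have toE C : cofinal D C -> exists2 C', @cofinal _ I^d E C' & C' #<= C.
  by apply: (chain_card_le tot) => //; exact: cut_nomax.
have toD C : @cofinal _ I^d E C -> exists2 C', cofinal D C' & C' #<= C.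
  apply: (@chain_card_le _ I^d F) => //; exact: (@cut_nomax _ I^d).
have [X [C [DC Cmin] _]] := cofinality_neq0 D.
have [Y [C' [EC' C'min] _]] := @cofinality_neq0 _ I^d E.
(* Transfer in both directions makes minimal cofinal and minimal coinitial sets equipotent, so the
   two classes coincide. *)
have least_le A A' : cofinal D A -> (forall B, cofinal D B -> A #<= B) ->
    @cofinal _ I^d E A' -> (forall B, @cofinal _ I^d E B -> A' #<= B) -> A #= A'.
  move=> DA Amin EA' A'min; rewrite card_eq_le; apply/andP; split.
    by have [B /Amin h] := toD A' EA'; exact: card_le_trans.
  by have [B /A'min h] := toE A DA; exact: card_le_trans.
apply/seteqP; split=> Z [A [cA Amin] ZA].
  exists C' => //; apply: card_eq_trans ZA _; exact: least_le.
exists C => //; apply: card_eq_trans ZA _; rewrite card_eq_sym; exact: least_le.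
Qed.

Theorem proposition1 (d : Order.disp_t) (I : orderType d) :
  spherically_complete I <->
  (forall D E : set I, cut D E -> ~ principal D E -> asymmetric D E).
Proof.
split; last exact: asymmetric_spherically_complete.
by move=> sc D E; exact: spherically_complete_asymmetric.
Qed.
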